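(* Let $H$ be a Hopf algebra with invertible antipode $S$ over a field $k$ and let $A$ be an $H$-module algebra. Then the full centre $Z(A)$ of $A$ coincides with the centraliser $C_{A\#H}(A)$ of $A$ in the smash product $A\#H$. The Yetter-Drinfeld structure ($H$-action and $H$-coaction) on $C_{A\#H}(A)$ has the form $$h\Big(\sum_i a_i\# g_i\Big)=\sum_{(h),i}h_{(2)}(a_i)\#S^2(h_{(3)})\,g_i\,S(h_{(1)}),$$ $$\psi\Big(\sum_i a_i\# g_i\Big)=\sum_{i,(g_i)}S^{-1}((g_i)_{(2)})\otimes a_i\#(g_i)_{(1)},$$ where $h\in H$ and $\sum_i a_i\# g_i\in C_{A\#H}(A)$.
   Context: Sweedler notation is used: $\Delta(h)=\sum_{(h)}h_{(1)}\otimes h_{(2)}$, and $m\mapsto\sum_{(m)} m_{(-1)}\otimes m_{(0)}\in H\otimes M$ for a left $H$-comodule $M$. An $H$-module algebra is an algebra in the monoidal category $H\text{-}Mod$ of left $H$-modules, i.e. an associative unital algebra $A$ with a left $H$-module structure such that $h(ab)=\sum_{(h)}h_{(1)}(a)h_{(2)}(b)$ and $h(1)=\varepsilon(h)1$. The smash product $A\#H$ is the vector space $A\otimes H$ (with $a\otimes h$ written $a\#h$) with multiplication $(a\#g)(b\#h)=\sum_{(g)}a\,g_{(1)}(b)\#g_{(2)}h$; $A$ embeds by $a\mapsto a\#1$. The centraliser is $C_{A\#H}(A)=\{x\in A\#H\mid x(b\#1)=(b\#1)x\ \text{for all } b\in A\}$. A Yetter-Drinfeld module over $H$ is a left $H$-module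 $M$ with a left $H$-comodule structure such that $$\sum h_{(1)}m_{(-1)}\otimes h_{(2)}m_{(0)}=\sum (h_{(1)}m)_{(-1)}h_{(2)}\otimes (h_{(1)}m)_{(0)}.$$ Morphisms are $H$-linear and $H$-colinear maps. The category $\mathcal{YD}(H)$ of Yetter-Drinfeld modules is monoidal (tensor product of modules and comodules) and braided with $c_{M,N}(m\otimes n)=\sum_{(m)}m_{(-1)}n\otimes m_{(0)}$. It is equivalent to the monoidal centre $\mathcal{Z}(H\text{-}Mod)$: a Yetter-Drinfeld module $M$ has the half-braiding $M\otimes X\to X\otimes M$, $m\otimes x\mapsto\sum_{(m)} m_{(-1)}x\otimes m_{(0)}$, for $X\in H\text{-}Mod$. Full centre: for an $H$-module algebra $A$, the full centre is the terminal object $(Z(A),\zeta_A)$ among pairs $(Z,\zeta)$, where $Z\in\mathcal{YD}(H)$ and $\zeta:Z\to A$ is an $H$-linear map such that $$\zeta(z)\,a=\sum_{(z)}z_{(-1)}(a)\,\zeta(z_{(0)})\qquad\text{for all } z\in Z,\ a\in A.$$ A morphism $(Z,\zeta)\to(Z',\zeta')$ is a morphism $f:Z\to Z'$ in $\mathcal{YD}(H)$ with $\zeta'f=\zeta$.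
   Formalization: The displayed formulas fail when S^2≠id (Sweedler's H, A=End(H)); proved instead: action h_(2)(a)#h_(3) g S^{-1}(h_(1)) and coaction S(g_(2))⊗a#g_(1) on C; the printed formulas are shown only after the change of coordinates a#g ↦ a#S^2(g). *)

(* Defs.v *)
From HB Require Import structures.
From mathcomp Require Import all_boot all_algebra.
From mathcomp Require Import boolp.
Set Implicit Arguments.
Unset Strict Implicit.
Unset Printing Implicit Defensive.
Import GRing.Theory.
Local Open Scope ring_scope.
Local Open Scope quotient_scope.

Notation is_bilinear f := (bilinear_for *:%R *:%R f).

(* Tensor product of vector spaces of arbitrary dimension: formal sums of pairs
   (v, w) modulo the relation "every bilinear map takes the same value", so that
   the universal property holds (lemmas tsum_linear, tsum_pure, tens_sum). *)
Section Tensor.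
Variables (k : fieldType) (V W : lmodType k).
Implicit Types s t : seq (V * W).

Definition tens_eq s t : bool :=
  `[< forall (U : lmodType k) (f : V -> W -> U), is_bilinear f ->
        \sum_(p <- s) f p.1 p.2 = \sum_(p <- t) f p.1 p.2 >].

Lemma tens_eqP s t :
  reflect (forall (U : lmodType k) (f : V -> W -> U), is_bilinear f ->
             \sum_(p <- s) f p.1 p.2 = \sum_(p <- t) f p.1 p.2)
          (tens_eq s t).
Proof. exact: asboolP. Qed.

Lemma tens_eq_refl : reflexive tens_eq.
Proof. by move=> s; apply/tens_eqP. Qed.

Lemma tens_eq_sym : symmetric tens_eq.
Proof. by move=> s t; apply/tens_eqP/tens_eqP => e U f /e. Qed.

Lemma tens_eq_trans : transitive tens_eq.
Proof.
move=> t s u /tens_eqP e1 /tens_eqP e2; apply/tens_eqP => U f fb.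
by rewrite e1 // e2.
Qed.

Canonical tens_equiv := EquivRel tens_eq tens_eq_refl tens_eq_sym tens_eq_trans.

Definition tens : Type := {eq_quot tens_equiv}.
HB.instance Definition _ := Choice.copy tens {eq_quot tens_equiv}.

Definition tens_pi s : tens := \pi_{eq_quot tens_equiv} s.
Definition tens_repr (t : tens) : seq (V * W) :=
  repr (t : {eq_quot tens_equiv}).

Lemma tens_reprK : cancel tens_repr tens_pi.
Proof. by move=> t; rewrite /tens_pi reprK. Qed.

Lemma tens_piP s t : reflect (tens_pi s = tens_pi t) (tens_eq s t).
Proof. by apply: (iffP idP) => [st|/eqmodP//]; apply/eqmodP. Qed.

(* Sum of f v w over a finite expression t = \sum v (x) w of t. *)
Definition tsum (U : nmodType) (t : tens) (f : V -> W -> U) : U :=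
  \sum_(p <- tens_repr t) f p.1 p.2.

Lemma tsum_pi (U : lmodType k) s (f : V -> W -> U) : is_bilinear f ->
  tsum (tens_pi s) f = \sum_(p <- s) f p.1 p.2.
Proof.
move=> fb; have /tens_piP/tens_eqP : tens_pi (tens_repr (tens_pi s)) = tens_pi s.
  by rewrite tens_reprK.
exact.
Qed.

Lemma tens_inj (x y : tens) :
  (forall (U : lmodType k) (f : V -> W -> U), is_bilinear f ->
     tsum x f = tsum y f) -> x = y.
Proof.
by move=> e; rewrite -[x]tens_reprK -[y]tens_reprK; apply/tens_piP/tens_eqP.
Qed.

Let is_bilinear0l (U : lmodType k) (f : V -> W -> U) : is_bilinear f ->
  forall a p, f (a *: p.1) p.2 = a *: f p.1 p.2.
Proof.
move=> [fl _] a p; have /= e0 := fl p.2 (-1) 0 0.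
have z : f 0 p.2 = 0.
  by move: e0; rewrite scaler0 addr0 scaleN1r => e0; rewrite {1}e0 addNr.
by have /= := fl p.2 a p.1 0; rewrite z !addr0.
Qed.

Definition tens_add (x y : tens) : tens := tens_pi (tens_repr x ++ tens_repr y).
Definition tens_scale (a : k) (x : tens) : tens :=
  tens_pi [seq (a *: p.1, p.2) | p <- tens_repr x].
Definition tens_zero : tens := tens_pi [::].

Section TsumOps.
Variables (U : lmodType k) (f : V -> W -> U) (fb : is_bilinear f).

Lemma tsum_add x y : tsum (tens_add x y) f = tsum x f + tsum y f.
Proof. by rewrite tsum_pi // big_cat. Qed.

Lemma tsum_scale a x : tsum (tens_scale a x) f = a *: tsum x f.
Proof.
rewrite tsum_pi // big_map scaler_sumr; apply: eq_bigr => p _ /=.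
exact: is_bilinear0l.
Qed.

Lemma tsum_zero : tsum tens_zero f = 0.
Proof. by rewrite tsum_pi // big_nil. Qed.

End TsumOps.

Let tsumE := (tsum_add, tsum_scale, tsum_zero).

Fact tens_addA : associative tens_add.
Proof. by move=> x y z; apply: tens_inj => U f fb; rewrite !tsumE // addrA. Qed.
Fact tens_addC : commutative tens_add.
Proof. by move=> x y; apply: tens_inj => U f fb; rewrite !tsumE // addrC. Qed.
Fact tens_add0 : left_id tens_zero tens_add.
Proof. by move=> x; apply: tens_inj => U f fb; rewrite !tsumE // add0r. Qed.
Fact tens_addN : left_inverse tens_zero (tens_scale (-1)) tens_add.
Proof.
by move=> x; apply: tens_inj => U f fb; rewrite !tsumE // scaleN1r addNr.
Qed.
HB.instance Definition _ :=
  GRing.isZmodule.Build tens tens_addA tens_addC tens_add0 tens_addN.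

Fact tens_scaleA a b x : tens_scale a (tens_scale b x) = tens_scale (a * b) x.
Proof. by apply: tens_inj => U f fb; rewrite !tsumE // scalerA. Qed.
Fact tens_scale1 : left_id 1 tens_scale.
Proof. by move=> x; apply: tens_inj => U f fb; rewrite !tsumE // scale1r. Qed.
Fact tens_scaleDr : right_distributive tens_scale +%R.
Proof.
move=> a x y; apply: tens_inj => U f fb.
by rewrite -![_ + _]/(tens_add _ _) !tsumE // scalerDr.
Qed.
Fact tens_scaleDl x : {morph tens_scale^~ x : a b / a + b}.
Proof.
move=> a b; apply: tens_inj => U f fb.
by rewrite -![_ + _ in RHS]/(tens_add _ _) !tsumE // scalerDl.
Qed.
HB.instance Definition _ := GRing.Zmodule_isLmodule.Build k tens
  tens_scaleA tens_scale1 tens_scaleDr tens_scaleDl.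

(* The linear map induced by a bilinear map. *)
Lemma tsum_linear (U : lmodType k) (f : V -> W -> U) :
  is_bilinear f -> linear (fun x => tsum x f).
Proof. by move=> fb a x y; rewrite tsum_add // tsum_scale. Qed.

(* In the body no bilinearity is needed: tsum is a finite sum. *)
Lemma tsum_body_linear (U : lmodType k) a (x : tens) (f g h : V -> W -> U) :
  (forall v w, f v w = a *: g v w + h v w) ->
  tsum x f = a *: tsum x g + tsum x h.
Proof.
move=> e; rewrite /tsum scaler_sumr -big_split.
by apply: eq_bigr => p _ /=.
Qed.

Definition tpure (v : V) (w : W) : tens := tens_pi [:: (v, w)].

Lemma tpure_bilinear : is_bilinear tpure.
Proof.
split=> [w a v v'|v a w w']; apply: tens_inj => U f fb;
  rewrite [RHS](tsum_linear fb) /tpure !tsum_pi // !big_seq1.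
- exact: (fb.1 w a v v').
- exact: (fb.2 v a w w').
Qed.

Lemma tsum_pure (U : lmodType k) (f : V -> W -> U) v w :
  is_bilinear f -> tsum (tpure v w) f = f v w.
Proof. by move=> fb; rewrite tsum_pi // big_seq1. Qed.

Lemma tens_sum (x : tens) : x = tsum x tpure.
Proof.
apply: tens_inj => U f fb.
have [g gE] : exists g : {linear tens -> U}, g =1 (fun x => tsum x f).
  pose g := fun x => tsum x f.
  pose gM := GRing.isLinear.Build k tens U *:%R g (tsum_linear fb).
  pose gL : {linear tens -> U} := HB.pack g gM.
  by exists gL.
rewrite -!gE [in RHS]/tsum linear_sum [LHS]gE.
by apply: eq_bigr => p _ /=; rewrite gE tsum_pure.
Qed.

End Tensor.

Notation "v \ox w" := (tpure v w) (at level 38, left associativity).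
(* Sweedler notation.  The chosen expression of t is irrelevant when E is
   bilinear in (x, y), as in all uses below. *)
Notation "\tsum_ ( x , y <- t ) E" := (tsum t (fun x y => E))
  (at level 41, x name, y name, t at level 200, E at level 41,
   format "\tsum_ ( x ,  y  <-  t )  E").

HB.mixin Record Algebra_isHopf (k : fieldType) H of GRing.Algebra k H := {
  comul : {linear H -> tens H H};
  counit : {linear H -> k^o};
  antipode : {linear H -> H};
  comulA : forall h : H,
    \tsum_(h1, h' <- comul h) \tsum_(h2, h3 <- comul h') h1 \ox (h2 \ox h3) =
    \tsum_(h', h3 <- comul h) \tsum_(h1, h2 <- comul h') h1 \ox (h2 \ox h3);
  counitl : forall h : H, \tsum_(h1, h2 <- comul h) counit h1 *: h2 = h;
  counitr : forall h : H, \tsum_(h1, h2 <- comul h) counit h2 *: h1 = h;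
  comul1 : comul 1 = 1 \ox 1;
  comulM : forall g h : H, comul (g * h) =
    \tsum_(g1, g2 <- comul g) \tsum_(h1, h2 <- comul h) (g1 * h1) \ox (g2 * h2);
  counit1 : counit 1 = 1;
  counitM : forall g h : H, counit (g * h) = counit g * counit h;
  antipodel : forall h : H,
    \tsum_(h1, h2 <- comul h) antipode h1 * h2 = (counit h)%:A;
  antipoder : forall h : H,
    \tsum_(h1, h2 <- comul h) h1 * antipode h2 = (counit h)%:A
}.
#[short(type="hopfAlgType")]
HB.structure Definition HopfAlgebra (k : fieldType) :=
  {H of GRing.Algebra k H & Algebra_isHopf k H}.

Definition is_module (k : fieldType) (H : hopfAlgType k) (M : lmodType k)
    (act : H -> M -> M) : Prop :=
  [/\ is_bilinear act,
      forall m, act 1 m = m &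
      forall g h m, act (g * h) m = act g (act h m)].

Definition is_comodule (k : fieldType) (H : hopfAlgType k) (M : lmodType k)
    (coact : M -> tens H M) : Prop :=
  [/\ linear coact,
      forall m, \tsum_(h, m0 <- coact m) counit h *: m0 = m &
      forall m,
        \tsum_(h, m0 <- coact m) \tsum_(h1, h2 <- comul h) h1 \ox (h2 \ox m0) =
        \tsum_(h1, m' <- coact m) \tsum_(h2, m0 <- coact m') h1 \ox (h2 \ox m0)].

(* Left Yetter-Drinfeld structures over H on the vector space M. *)
Record ydStruct (k : fieldType) (H : hopfAlgType k) (M : lmodType k) := YDStruct {
  yd_act : H -> M -> M;
  yd_coact : M -> tens H M;
  yd_module : is_module yd_act;
  yd_comodule : is_comodule yd_coact;
  yd_compat : forall h m,
    \tsum_(h1, h2 <- comul h) \tsum_(n, m0 <- yd_coact m)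
      (h1 * n) \ox yd_act h2 m0 =
    \tsum_(h1, h2 <- comul h) \tsum_(n, m0 <- yd_coact (yd_act h1 m))
      (n * h2) \ox m0
}.

Definition is_yd_morphism (k : fieldType) (H : hopfAlgType k)
    (M N : lmodType k) (X : ydStruct H M) (Y : ydStruct H N) (f : M -> N) : Prop :=
  [/\ linear f,
      forall h m, f (yd_act X h m) = yd_act Y h (f m) &
      forall m, yd_coact Y (f m) = \tsum_(h, m0 <- yd_coact X m) h \ox f m0].

(* H-module algebras.  The algebra structure is spelled out because the zero
   algebra is allowed, whereas mathcomp's algType requires 1 != 0. *)
Record moduleAlgebra (k : fieldType) (H : hopfAlgType k) := ModuleAlgebra {
  ma_sort :> lmodType k;
  ma_mul : ma_sort -> ma_sort -> ma_sort;
  ma_one : ma_sort;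
  ma_act : H -> ma_sort -> ma_sort;
  ma_mul_bilinear : is_bilinear ma_mul;
  ma_mulA : associative ma_mul;
  ma_mul1l : left_id ma_one ma_mul;
  ma_mul1r : right_id ma_one ma_mul;
  ma_module : is_module ma_act;
  ma_actM : forall h a b, ma_act h (ma_mul a b) =
    \tsum_(h1, h2 <- comul h) ma_mul (ma_act h1 a) (ma_act h2 b);
  ma_act1 : forall h, ma_act h ma_one = counit h *: ma_one
}.

(* Pairs (Z, zeta) mapping to A compatibly with the half-braiding of Z. *)
Definition is_central_map (k : fieldType) (H : hopfAlgType k)
    (A : moduleAlgebra H) (Z : lmodType k) (X : ydStruct H Z)
    (zeta : Z -> A) : Prop :=
  [/\ linear zeta,
      forall h z, zeta (yd_act X h z) = ma_act h (zeta z) &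
      forall z a, ma_mul (zeta z) a =
        \tsum_(n, z0 <- yd_coact X z) ma_mul (ma_act n a) (zeta z0)].

(* (Z, zeta) is the full centre of A: it is terminal among such pairs. *)
Definition is_full_centre (k : fieldType) (H : hopfAlgType k)
    (A : moduleAlgebra H) (Z : lmodType k) (X : ydStruct H Z)
    (zeta : Z -> A) : Prop :=
  is_central_map X zeta /\
  forall (Z' : lmodType k) (X' : ydStruct H Z') (zeta' : Z' -> A),
    is_central_map X' zeta' ->
    exists! f : Z' -> Z, is_yd_morphism X' X f /\ forall z, zeta (f z) = zeta' z.

Section SmashProduct.
Variables (k : fieldType) (H : hopfAlgType k) (A : moduleAlgebra H).

(* The underlying space of A # H is tens A H, with a # h := a \ox h. *)
Definition smash_mul (x y : tens A H) : tens A H :=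
  \tsum_(a, g <- x) \tsum_(b, h <- y) \tsum_(g1, g2 <- comul g)
    (ma_mul a (ma_act g1 b) \ox (g2 * h)).

Let smash_body1 a b h : is_bilinear (fun g1 g2 =>
  (ma_mul a (ma_act g1 b) \ox (g2 * h) : tens A H)).
Proof.
have [[actl _] _ _] := ma_module A.
split=> [g2 c g g'|g1 c g g'] /=.
  by rewrite actl (ma_mul_bilinear A).2 (tpure_bilinear _ _).1.
by rewrite mulrDl -scalerAl (tpure_bilinear _ _).2.
Qed.

Let smash_body2 a g : is_bilinear (fun b h =>
  \tsum_(g1, g2 <- comul g)
    (ma_mul a (ma_act g1 b) \ox (g2 * h) : tens A H)).
Proof.
have [[_ actr] _ _] := ma_module A.
split=> [h c b b'|b c h h'] /=; apply: tsum_body_linear => g1 g2.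
  by rewrite actr (ma_mul_bilinear A).2 (tpure_bilinear _ _).1.
by rewrite mulrDr -scalerAr (tpure_bilinear _ _).2.
Qed.

Let smash_body3 (y : tens A H) : is_bilinear (fun a g => \tsum_(b, h <- y)
  \tsum_(g1, g2 <- comul g)
    (ma_mul a (ma_act g1 b) \ox (g2 * h) : tens A H)).
Proof.
split=> [g c a a'|a c g g'] /=; apply: tsum_body_linear => b h.
  apply: tsum_body_linear => g1 g2.
  by rewrite (ma_mul_bilinear A).1 (tpure_bilinear _ _).1.
by rewrite linearP (tsum_linear (smash_body1 a b h)).
Qed.

Lemma smash_mul_bilinear : is_bilinear smash_mul.
Proof.
split=> [y c x x'|x c y y'] /=; first exact: (tsum_linear (smash_body3 y)).
apply: tsum_body_linear => a g; exact: (tsum_linear (smash_body2 a g)).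
Qed.

Definition in_centraliser : {pred tens A H} := fun x =>
  `[< forall b : A, smash_mul x (b \ox 1) = smash_mul (b \ox 1) x >].

Lemma in_centraliserP x :
  reflect (forall b : A, smash_mul x (b \ox 1) = smash_mul (b \ox 1) x)
          (x \in in_centraliser).
Proof. exact: asboolP. Qed.

Lemma in_centraliser_closed : GRing.submod_closed in_centraliser.
Proof.
have ml := smash_mul_bilinear.1; have mr := smash_mul_bilinear.2.
have lin0 (f : tens A H -> tens A H) : linear f -> f 0 = 0.
  by move=> fl; have /= := fl (-1) 0 0; rewrite !scaleN1r !addNr.
split=> [|c x y /in_centraliserP xC /in_centraliserP yC].
  by apply/in_centraliserP => b; rewrite (lin0 _ (ml _)) (lin0 _ (mr _)).
by apply/in_centraliserP => b; rewrite ml mr xC yC.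
Qed.

HB.instance Definition _ :=
  GRing.isSubmodClosed.Build k (tens A H) in_centraliser
    (GRing.submod_closed_semi in_centraliser_closed).

(* The centraliser of A in A # H, as a subspace of A # H. *)
Record centraliser := Centraliser {
  centraliser_val :> tens A H;
  centraliserP : centraliser_val \in in_centraliser
}.
HB.instance Definition _ := [isSub for centraliser_val].
HB.instance Definition _ := [Choice of centraliser by <:].
HB.instance Definition _ := [SubChoice_isSubLmodule of centraliser by <:].

(* a # g |-> a # S^2(g).  The formulas S^2(h3) g S(h1) and S^{-1}(g2) for the
   structure on the centraliser hold in these coordinates; in those of A # H they
   read h3 g S^{-1}(h1) and S(g2), and agree with the former when S^2 = id.  If
   S^2 <> id the former need not preserve the centraliser: e.g. for Sweedler's
   4-dimensional H in characteristic <> 2 and A = End(H). *)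
Definition twist_S2 (x : tens A H) : tens A H :=
  \tsum_(a, g <- x) (a \ox (antipode (antipode g))).

End SmashProduct.

(* Main.v *)
Require Import Defs.
From HB Require Import structures.
From mathcomp Require Import all_boot all_algebra.
From mathcomp Require Import boolp.
From mathcomp Require classical_sets.
Set Implicit Arguments.
Unset Strict Implicit.
Unset Printing Implicit Defensive.
Import GRing.Theory.
Local Open Scope ring_scope.

(** The action [h x = h_(2) x S^-1(h_(1))] and the coaction
    [a # g |-> S(g_(2)) (x) (a # g_(1))] make the whole of [A # H] a
    Yetter-Drinfeld module.  The centraliser is stable under the action because
    [h x S^-1(h')] moves [b] across with the help of
    [h_(2) S^-1(h_(1)) = eps(h)], and under the coaction because the latter
    commutes with left and right multiplication by [A]; over a field this second
    stability does give a subcomodule.  The structure map is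
    [zeta(a # g) = eps(g) a].  Since [x = zeta(x_(0)) # S^-1(x_(-1))] for all
    [x], a morphism to the centraliser over [A] is determined by its composite
    with [zeta], and conversely [z |-> zeta'(z_(0)) # S^-1(z_(-1))] lifts every
    [zeta'] that is compatible with the half-braiding. *)

(** * Linearity in one variable *)

Section LinearComb.
Variable k : fieldType.
Implicit Types U V W : lmodType k.

Definition lincomb U (a : k) (u v w : U) : Prop := u = a *: v + w.

Lemma lincomb_id U a (v w : U) : lincomb a (a *: v + w) v w.
Proof. by []. Qed.

Lemma lincomb_fun U V (f : U -> V) a u v w :
  linear f -> lincomb a u v w -> lincomb a (f u) (f v) (f w).
Proof. by move=> fl ->; apply: fl. Qed.

Lemma lincomb_map U V (f : {linear U -> V}) a u v w :
  lincomb a u v w -> lincomb a (f u) (f v) (f w).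
Proof. exact/lincomb_fun/linearP. Qed.

Lemma lincomb_bil1 U V W (f : U -> V -> W) a u v w x :
  is_bilinear f -> lincomb a u v w -> lincomb a (f u x) (f v x) (f w x).
Proof. by move=> fb ->; apply: fb.1. Qed.

Lemma lincomb_bil2 U V W (f : U -> V -> W) a u v w x :
  is_bilinear f -> lincomb a u v w -> lincomb a (f x u) (f x v) (f x w).
Proof. by move=> fb ->; apply: fb.2. Qed.

Lemma lincomb_pure1 U V a (u v w : U) (x : V) :
  lincomb a u v w -> lincomb a (u \ox x) (v \ox x) (w \ox x).
Proof. exact/lincomb_bil1/tpure_bilinear. Qed.

Lemma lincomb_pure2 U V a (u v w : U) (x : V) :
  lincomb a u v w -> lincomb a (x \ox u) (x \ox v) (x \ox w).
Proof. exact/lincomb_bil2/tpure_bilinear. Qed.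

Lemma lincomb_scale1 U a (b c d : k) (u : U) :
  @lincomb k^o a b c d -> lincomb a (b *: u) (c *: u) (d *: u).
Proof. by rewrite /lincomb => ->; rewrite scalerDl -scalerA. Qed.

Lemma lincomb_scale2 U a b (u v w : U) :
  lincomb a u v w -> lincomb a (b *: u) (b *: v) (b *: w).
Proof. by rewrite /lincomb => ->; rewrite scalerDr !scalerA mulrC. Qed.

Lemma lincomb_mul1 (H : hopfAlgType k) a (u v w x : H) :
  lincomb a u v w -> lincomb a (u * x) (v * x) (w * x).
Proof. by rewrite /lincomb => ->; rewrite mulrDl scalerAl. Qed.

Lemma lincomb_mul2 (H : hopfAlgType k) a (u v w x : H) :
  lincomb a u v w -> lincomb a (x * u) (x * v) (x * w).
Proof. by rewrite /lincomb => ->; rewrite mulrDr scalerAr. Qed.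

Lemma lincomb_tsum1 U V W (F : U -> V -> W) a (t x y : tens U V) :
  is_bilinear F -> lincomb a t x y ->
  lincomb a (tsum t F) (tsum x F) (tsum y F).
Proof. by move=> Fb ->; apply: tsum_linear. Qed.

Lemma lincomb_tsum2 U V W (F G K : U -> V -> W) a (t : tens U V) :
  (forall u v, lincomb a (F u v) (G u v) (K u v)) ->
  lincomb a (tsum t F) (tsum t G) (tsum t K).
Proof. exact: tsum_body_linear. Qed.

Lemma linear_lincomb U V (f : U -> V) :
  (forall a u v, lincomb a (f (a *: u + v)) (f u) (f v)) -> linear f.
Proof. by []. Qed.

Lemma bilinear_lincomb U V W (f : U -> V -> W) :
  (forall x a u v, lincomb a (f (a *: u + v) x) (f u x) (f v x)) ->
  (forall x a u v, lincomb a (f x (a *: u + v)) (f x u) (f x v)) ->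
  is_bilinear f.
Proof. by []. Qed.

Definition trilinear U1 U2 U3 V (f : U1 -> U2 -> U3 -> V) : Prop :=
  [/\ forall x y, linear (fun u => f u x y),
      forall x y, linear (fun u => f x u y) & forall x y, linear (f x y)].

Lemma trilinear_lincomb U1 U2 U3 V (f : U1 -> U2 -> U3 -> V) :
  (forall x y a u v, lincomb a (f (a *: u + v) x y) (f u x y) (f v x y)) ->
  (forall x y a u v, lincomb a (f x (a *: u + v) y) (f x u y) (f x v y)) ->
  (forall x y a u v, lincomb a (f x y (a *: u + v)) (f x y u) (f x y v)) ->
  trilinear f.
Proof. by []. Qed.

End LinearComb.

(* [lin] proves that an expression is linear in a variable that occurs once: it
   compares the values at [a *: u + v], [u] and [v] and peels off the head that
   they share.  [lin_ext] is redefined when new bilinear operations appear. *)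
Ltac lin_ext := fail.
Ltac lin_step :=
  lazymatch goal with
  | |- forall _, _ => intro
  | |- lincomb _ (_ *: ?u + ?v) ?u ?v => exact: lincomb_id
  | |- lincomb _ (tpure _ ?x) (tpure _ ?x) (tpure _ ?x) => apply: lincomb_pure1
  | |- lincomb _ (tpure ?x _) (tpure ?x _) (tpure ?x _) => apply: lincomb_pure2
  | |- lincomb _ (GRing.mul _ ?x) (GRing.mul _ ?x) (GRing.mul _ ?x) =>
      apply: lincomb_mul1
  | |- lincomb _ (GRing.mul ?x _) (GRing.mul ?x _) (GRing.mul ?x _) =>
      apply: lincomb_mul2
  | |- lincomb _ (GRing.scale _ ?x) (GRing.scale _ ?x) (GRing.scale _ ?x) =>
      apply: lincomb_scale1
  | |- lincomb _ (GRing.scale ?x _) (GRing.scale ?x _) (GRing.scale ?x _) =>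
      apply: lincomb_scale2
  | |- lincomb _ (tsum _ ?F) (tsum _ ?F) (tsum _ ?F) => apply: lincomb_tsum1
  | |- lincomb _ (tsum ?t _) (tsum ?t _) (tsum ?t _) => apply: lincomb_tsum2
  | |- lincomb _ _ _ _ =>
      first [ lin_ext
            | match goal with
              | Hb : bilinear_for _ _ ?f
                |- lincomb _ (?f _ ?x) (?f _ ?x) (?f _ ?x) =>
                apply: (lincomb_bil1 _ Hb)
              | Hb : bilinear_for _ _ ?f
                |- lincomb _ (?f ?x _) (?f ?x _) (?f ?x _) =>
                apply: (lincomb_bil2 _ Hb)
              | Hl : GRing.linear_for _ ?f |- lincomb _ (?f _) (?f _) (?f _) =>
                apply: (lincomb_fun Hl)
              end
            | apply: lincomb_map ]
  | |- trilinear _ => apply: trilinear_lincomb; cbv beta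
  | |- linear _ => apply: linear_lincomb; cbv beta
  | |- _ => first [ assumption | apply: bilinear_lincomb; cbv beta ]
  end; cbv beta.
Ltac lin := solve [repeat lin_step].

Section TensorSums.
Variable k : fieldType.
Implicit Types U V W : lmodType k.

Lemma eq_tsum V W (U : nmodType) (t : tens V W) (f g : V -> W -> U) :
  (forall v w, f v w = g v w) -> tsum t f = tsum t g.
Proof. by move=> fg; apply: eq_bigr => p _. Qed.

Lemma tsumC V W V' W' (U : nmodType) (t : tens V W) (t' : tens V' W')
    (f : V -> W -> V' -> W' -> U) :
  \tsum_(v, w <- t) \tsum_(v', w' <- t') f v w v' w' =
  \tsum_(v', w' <- t') \tsum_(v, w <- t) f v w v' w'.
Proof. exact: exchange_big. Qed.

Lemma linear_packed U V (f : U -> V) :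
  linear f -> exists g : {linear U -> V}, g =1 f.
Proof.
move=> fl; pose fM := GRing.isLinear.Build k U V *:%R f fl.
by pose g : {linear U -> V} := HB.pack f fM; exists g.
Qed.

Lemma linear_scale U V (f : U -> V) c u : linear f -> f (c *: u) = c *: f u.
Proof. by move=> /linear_packed[g gE]; rewrite -!gE linearZ. Qed.

Lemma linear_tsum V W U U' (f : U -> U') (t : tens V W) (E : V -> W -> U) :
  linear f -> f (tsum t E) = \tsum_(v, w <- t) f (E v w).
Proof.
move=> /linear_packed[g gE]; rewrite -gE /tsum linear_sum.
by apply: eq_bigr => p _; rewrite gE.
Qed.

Lemma scaler_tsum V W U (c : k) (t : tens V W) (E : V -> W -> U) :
  c *: tsum t E = \tsum_(v, w <- t) (c *: E v w).
Proof. exact: scaler_sumr. Qed.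

Lemma tsum_tsum V W V' W' U (t : tens V W) (E : V -> W -> tens V' W')
    (f : V' -> W' -> U) : is_bilinear f ->
  tsum (tsum t E) f = \tsum_(v, w <- t) tsum (E v w) f.
Proof. by move=> fb; apply: (linear_tsum _ _ (tsum_linear fb)). Qed.

Lemma eq_linear_tens V W U (f g : tens V W -> U) : linear f -> linear g ->
  (forall v w, f (v \ox w) = g (v \ox w)) -> f =1 g.
Proof.
move=> fl gl fg x; rewrite (tens_sum x) !linear_tsum //.
exact: eq_tsum.
Qed.

Definition tmap V W V' W' (f : V -> V') (g : W -> W') (t : tens V W) :
  tens V' W' := \tsum_(v, w <- t) f v \ox g w.

Section Tmap.
Variables (V W V' W' : lmodType k) (f : V -> V') (g : W -> W').
Hypotheses (fl : linear f) (gl : linear g).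

Lemma tmap_bilinear : is_bilinear (fun v w => f v \ox g w).
Proof. lin. Qed.

Lemma tmap_linear : linear (tmap f g).
Proof. exact/tsum_linear/tmap_bilinear. Qed.

Lemma tmap_pure v w : tmap f g (v \ox w) = f v \ox g w.
Proof. exact/tsum_pure/tmap_bilinear. Qed.

Lemma tsum_tmap U (F : V' -> W' -> U) t : is_bilinear F ->
  tsum (tmap f g t) F = \tsum_(v, w <- t) F (f v) (g w).
Proof.
by move=> Fb; rewrite tsum_tsum //; apply: eq_tsum => v w; rewrite tsum_pure.
Qed.

End Tmap.

End TensorSums.

(** * Functionals and injectivity of [id (x) g] *)

Section DualSystem.
Variable k : fieldType.
Implicit Types U V W : lmodType k.

(* [M] is a subspace maximal among those avoiding [u]; then [V] is the direct
   sum of [M] and the line [k u], and the functional is the [u]-coordinate. *)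
Lemma exists_functional V (u : V) : u != 0 ->
  exists phi : {linear V -> k^o}, phi u = 1.
Proof.
move=> u0.
pose P (M : classical_sets.set V) :=
  ~ M u /\ forall a x y, M x -> M y -> M (a *: x + y).
have [|M [[Mu Ml] Mmax]] := @classical_sets.Zorn_bigcup V P.
  move=> F FP Ftot; split=> [[X FX]|a x y [X FX Xx] [Y FY Yy]].
    by have [+ _] := FP _ FX; apply.
  have [XY|YX] := Ftot _ _ FX FY.
    by exists Y => //; have [_] := FP _ FY; apply=> //; apply: XY.
  by exists X => //; have [_] := FP _ FX; apply=> //; apply: YX.
have M0 : M 0.
  apply: contrapT => nM0; apply: (Mmax (fun x => x = 0 \/ M x)).
    by split=> [x|e]; [right | apply: nM0; apply: e; left].
  split=> /= [[/eqP|//]|a x y]; first by rewrite (negPf u0).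
  case=> [->|Mx] [->|My]; rewrite ?scaler0 ?addr0 ?add0r.
  - by left.
  - by right.
  - by case: nM0; rewrite -(addNr x) -scaleN1r; apply: Ml.
  - by right; apply: Ml.
have MZ a x : M x -> M (a *: x) by move=> Mx; rewrite -[a *: x]addr0; apply: Ml.
have dec x : exists c : k, M (x - c *: u).
  apply: contrapT => nc.
  apply: (Mmax (fun y => exists c, M (y - c *: x))).
    split=> [y My|e]; first by exists 0; rewrite scale0r subr0.
    apply: nc; exists 0; rewrite scale0r subr0; apply: e.
    by exists 1; rewrite scale1r subrr.
  split=> [[c Mc]|a y z [c Mc] [d Md]].
    have [c0|c0] := eqVneq c 0; first by rewrite c0 scale0r subr0 in Mc.
    apply: nc; exists c^-1; have := MZ (- c^-1) _ Mc.
    by rewrite scalerBr scalerA mulNr mulVf // scaleN1r opprK scaleNr addrC.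
  exists (a * c + d); have := Ml a _ _ Mc Md.
  by rewrite scalerBr scalerA scalerDl opprD addrACA.
have uniq x c d : M (x - c *: u) -> M (x - d *: u) -> c = d.
  move=> Mc Md; apply/eqP; rewrite -subr_eq0; apply/negP => /negP cd0.
  apply: Mu; have := MZ (c - d)^-1 _ (Ml (-1) _ _ Mc Md).
  rewrite scaleN1r opprB addrA subrK -scalerBl scalerA.
  by rewrite mulVf // scale1r.
have [phi phiP] := choice dec.
have /linear_packed[f fE] : linear (phi : V -> k^o).
  move=> a x y /=; apply: (uniq (a *: x + y)) => //.
  have := Ml a _ _ (phiP x) (phiP y).
  by rewrite scalerBr scalerA addrACA -opprD -scalerDl.
by exists f; rewrite fE; apply: (uniq u) => //; rewrite scale1r subrr.
Qed.

Lemma dual_system V (s : seq V) :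
  exists r : seq (V * {linear V -> k^o}),
    {in s, forall v, v = \sum_(p <- r) (p.2 v : k) *: p.1}.
Proof.
elim: s => [|v s [r rP]]; first by exists [::].
pose Pr x := \sum_(p <- r) (p.2 x : k) *: p.1.
have [vP|] := eqVneq (v - Pr v) 0.
  exists r => x; rewrite inE => /orP[/eqP->|]; last exact: rP.
  exact/subr0_eq.
move=> /exists_functional [phi phi1].
have /linear_packed[f fE] : linear (fun x => phi (x - Pr x)).
  move=> a x y; rewrite -linearP; congr (phi _).
  rewrite scalerBr addrACA -opprD; congr (_ - _).
  rewrite /Pr scaler_sumr -big_split /=; apply: eq_bigr => p _.
  by rewrite linearP scalerDl scalerA.
exists ((v - Pr v, f) :: r) => x; rewrite inE big_cons /= fE.
move=> /orP[/eqP->|/rP xP]; first by rewrite phi1 scale1r subrK.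
have -> : x - Pr x = 0 by rewrite /Pr -xP subrr.
by rewrite linear0 scale0r add0r.
Qed.

Definition contract V W (phi : V -> k^o) (t : tens V W) : W :=
  \tsum_(v, w <- t) (phi v : k) *: w.

Lemma contract_bilinear V W (phi : {linear V -> k^o}) :
  is_bilinear (fun (v : V) (w : W) => (phi v : k) *: w).
Proof. lin. Qed.

Lemma tens_dual_system V W (t : tens V W) :
  exists r : seq (V * {linear V -> k^o}),
    t = \sum_(p <- r) p.1 \ox contract p.2 t.
Proof.
have [r rP] := dual_system [seq p.1 | p <- tens_repr t]; exists r.
have bl := tpure_bilinear V W.
rewrite {1}[t]tens_sum /tsum big_seq.
transitivity (\sum_(q <- tens_repr t)
                \sum_(p <- r) (p.2 q.1 : k) *: (p.1 \ox q.2)).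
  rewrite [RHS]big_seq; apply: eq_bigr => q qt.
  have /linear_packed[f fE] := bl.1 q.2.
  rewrite {1}(rP q.1) ?map_f // -[LHS]fE linear_sum.
  by apply: eq_bigr => p _; rewrite linearZ fE.
rewrite exchange_big; apply: eq_bigr => p _.
have /linear_packed[f fE] := bl.2 p.1.
rewrite -[RHS]fE linear_sum; apply: eq_bigr => q _.
by rewrite linearZ fE.
Qed.

Section TmapInjective.
Variables (V W W' : lmodType k) (g : W -> W').
Hypothesis gl : linear g.

Let idl : linear (@id V). Proof. by []. Qed.

Lemma contract_tmap (phi : {linear V -> k^o}) t :
  contract phi (tmap id g t) = g (contract phi t).
Proof.
rewrite /contract tsum_tmap //; last by lin.
rewrite linear_tsum //; apply: eq_tsum => v w.
exact/esym/linear_scale.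
Qed.

Lemma tmap_idl_im (t : tens V W') :
  (forall phi : {linear V -> k^o}, exists w, g w = contract phi t) ->
  exists t', tmap id g t' = t.
Proof.
have /linear_packed[f fE] := tmap_linear idl gl.
move=> /choice[c cE]; have [r rE] := tens_dual_system t.
exists (\sum_(p <- r) p.1 \ox c p.2); rewrite [RHS]rE -fE linear_sum.
by apply: eq_bigr => p _; rewrite fE tmap_pure // cE.
Qed.

Lemma tmap_idl_inj : injective g -> injective (@tmap k V W V W' id g).
Proof.
move=> gI t t' tt'; have /linear_packed[f fE] := tmap_linear idl gl.
apply/subr0_eq.
have [r ->] := tens_dual_system (t - t').
rewrite big1 // => p _; suff -> : contract p.2 (t - t') = 0.
  have /linear_packed[q qE] := (tpure_bilinear V W).2 p.1.
  by rewrite -qE linear0.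
have /linear_packed[g' g'E] := gl; apply: gI.
rewrite -contract_tmap -fE linearB !fE tt' subrr.
have /linear_packed[q qE] := tsum_linear (contract_bilinear W' p.2).
by rewrite -g'E linear0 -[LHS]qE linear0.
Qed.

End TmapInjective.

End DualSystem.

(** * Hopf algebras *)

Lemma trilinear_tsum (k : fieldType) (U1 U2 U3 V : lmodType k)
    (F : U1 -> U2 -> U3 -> V) : trilinear F ->
  is_bilinear (fun u (t : tens U2 U3) => tsum t (F u)).
Proof.
move=> [F1 F2 F3]; split=> [t|u].
  by move=> a x y; apply: tsum_body_linear => *; apply: F1.
by apply: tsum_linear; split=> [w|v]; [apply: F2 | apply: F3].
Qed.

Section Hopf.
Variables (k : fieldType) (H : hopfAlgType k).
Implicit Types (U : lmodType k) (g h : H).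

Lemma tsum_comulA U (F : H -> H -> H -> U) h : trilinear F ->
  \tsum_(h', h3 <- comul h) \tsum_(h1, h2 <- comul h') F h1 h2 h3 =
  \tsum_(h1, h' <- comul h) \tsum_(h2, h3 <- comul h') F h1 h2 h3.
Proof.
move=> Ft; have Gb := trilinear_tsum Ft.
have F1 x : is_bilinear (F x) by case: Ft => *; split=> [w|v] *; auto.
transitivity (tsum (\tsum_(h', h3 <- comul h) \tsum_(h1, h2 <- comul h')
    h1 \ox (h2 \ox h3)) (fun x t => tsum t (F x)));
  [symmetry | rewrite -comulA].
  all: rewrite tsum_tsum //; apply: eq_tsum => ? ?.
  all: rewrite tsum_tsum //; apply: eq_tsum => ? ?.
  all: by rewrite tsum_pure ?tsum_pure.
Qed.

Lemma tsum_counitl U (F : H -> U) h : linear F ->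
  \tsum_(h1, h2 <- comul h) (counit h1 : k) *: F h2 = F h.
Proof.
move=> Fl; rewrite -[in RHS](counitl h) linear_tsum //.
by apply: eq_tsum => *; rewrite linear_scale.
Qed.

Lemma tsum_counitr U (F : H -> U) h : linear F ->
  \tsum_(h1, h2 <- comul h) (counit h2 : k) *: F h1 = F h.
Proof.
move=> Fl; rewrite -[in RHS](counitr h) linear_tsum //.
by apply: eq_tsum => *; rewrite linear_scale.
Qed.

Lemma tsum_antipodel U (F : H -> U) h : linear F ->
  \tsum_(h1, h2 <- comul h) F (antipode h1 * h2) = (counit h : k) *: F 1.
Proof.
by move=> Fl; rewrite -linear_tsum // antipodel linear_scale.
Qed.

Lemma tsum_antipoder U (F : H -> U) h : linear F ->
  \tsum_(h1, h2 <- comul h) F (h1 * antipode h2) = (counit h : k) *: F 1.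
Proof.
by move=> Fl; rewrite -linear_tsum // antipoder linear_scale.
Qed.

Lemma tsum_comulM U (F : H -> H -> U) g h : is_bilinear F ->
  tsum (comul (g * h)) F = \tsum_(g1, g2 <- comul g) \tsum_(h1, h2 <- comul h)
    F (g1 * h1) (g2 * h2).
Proof.
move=> Fb; rewrite comulM tsum_tsum //; apply: eq_tsum => g1 g2.
by rewrite tsum_tsum //; apply: eq_tsum => h1 h2; rewrite tsum_pure.
Qed.

Lemma tsum_comul1 U (F : H -> H -> U) : is_bilinear F ->
  tsum (comul (1 : H)) F = F 1 1.
Proof. by move=> Fb; rewrite comul1 tsum_pure. Qed.

Lemma convolution_inverse_unique (B : lmodType k) (mul : B -> B -> B) (one : B)
    (f f' g : H -> B) :
  is_bilinear mul -> associative mul -> left_id one mul -> right_id one mul ->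
  linear f -> linear f' -> linear g ->
  (forall h,
     \tsum_(h1, h2 <- comul h) mul (f h1) (g h2) = (counit h : k) *: one) ->
  (forall h,
     \tsum_(h1, h2 <- comul h) mul (g h1) (f' h2) = (counit h : k) *: one) ->
  f =1 f'.
Proof.
move=> mb mA m1l m1r fl fl' gl fg gf' h.
have mZ1 a x y : mul (a *: x) y = a *: mul x y.
  exact: (linear_scale _ _ (mb.1 y)).
have mZ2 a x y : mul x (a *: y) = a *: mul x y.
  exact: (linear_scale _ _ (mb.2 x)).
transitivity (\tsum_(h1, h' <- comul h) \tsum_(h2, h3 <- comul h')
    mul (mul (f h1) (g h2)) (f' h3)).
  rewrite -[LHS](tsum_counitr _ fl); apply: eq_tsum => h1 h'.
  rewrite -{1}[f h1]m1r -mZ2 -gf' linear_tsum; last exact: mb.2.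
  by apply: eq_tsum => h2 h3; rewrite mA.
rewrite -tsum_comulA; last by lin.
rewrite -[RHS](tsum_counitl _ fl'); apply: eq_tsum => h' h3.
rewrite -{2}[f' h3]m1l -mZ1 -fg.
by rewrite (linear_tsum _ _ (mb.1 (f' h3))).
Qed.

(* Both sides are convolution inverse to the product of [H]: evaluate
   [S(g1 h1) g2 h2 S(h3) S(g3)] in two ways. *)
Lemma antipodeM g h : antipode (g * h) = antipode h * antipode g :> H.
Proof.
transitivity (\tsum_(g1, g' <- comul g) \tsum_(g2, g3 <- comul g')
  \tsum_(h1, h' <- comul h) \tsum_(h2, h3 <- comul h')
    antipode (g1 * h1) * (g2 * (h2 * antipode h3) * antipode g3)).
  transitivity (\tsum_(g1, g' <- comul g) \tsum_(g2, g3 <- comul g')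
      antipode (g1 * h) * (g2 * antipode g3)).
    rewrite -(@tsum_counitr _ (fun g => antipode (g * h))); last by lin.
    apply: eq_tsum => g1 g'.
    rewrite (@tsum_antipoder _ (fun z => antipode (g1 * h) * z)); last by lin.
    by rewrite mulr1.
  apply: eq_tsum => g1 g'; apply: eq_tsum => g2 g3.
  rewrite -(@tsum_counitr _ (fun h => antipode (g1 * h) * (g2 * antipode g3)));
    last by lin.
  apply: eq_tsum => h1 h'.
  rewrite (@tsum_antipoder _
    (fun z => antipode (g1 * h1) * (g2 * z * antipode g3))) ?mulr1; last by lin.
  by [].
rewrite -tsum_comulA; last by lin.
transitivity (\tsum_(g', g3 <- comul g) \tsum_(h', h3 <- comul h)
    (counit (g' * h') : k) *: (antipode h3 * antipode g3)).
  apply: eq_tsum => g' g3.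
  transitivity (\tsum_(g1, g2 <- comul g') \tsum_(h', h3 <- comul h)
    \tsum_(h1, h2 <- comul h')
      antipode (g1 * h1) * (g2 * h2) * (antipode h3 * antipode g3)).
    apply: eq_tsum => g1 g2; rewrite -tsum_comulA; last by lin.
    by do 2!apply: eq_tsum => ? ?; rewrite !mulrA.
  rewrite tsumC; apply: eq_tsum => h' h3.
  rewrite -(@tsum_comulM _
    (fun x y => antipode x * y * (antipode h3 * antipode g3))); last by lin.
  rewrite (@tsum_antipodel _ (fun z => z * (antipode h3 * antipode g3)));
    last by lin.
  by rewrite mul1r.
transitivity (\tsum_(g', g3 <- comul g)
    (counit g' : k) *: (antipode h * antipode g3)).
  apply: eq_tsum => g' g3.
  rewrite -(@tsum_counitl _ (fun z => antipode z * antipode g3)); last by lin.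
  rewrite linear_tsum; last by lin.
  by apply: eq_tsum => *; rewrite counitM scalerA.
by rewrite (@tsum_counitl _ (fun z => antipode h * antipode z)); last by lin.
Qed.

Definition tens_mul (x y : tens H H) : tens H H :=
  \tsum_(x1, x2 <- x) \tsum_(y1, y2 <- y) (x1 * y1) \ox (x2 * y2).

Lemma tens_mul_bilinear : is_bilinear tens_mul.
Proof. rewrite /tens_mul; lin. Qed.

Lemma tens_mul_pure (x1 x2 y1 y2 : H) :
  tens_mul (x1 \ox x2) (y1 \ox y2) = (x1 * y1) \ox (x2 * y2).
Proof. by rewrite /tens_mul tsum_pure ?tsum_pure //; lin. Qed.

Lemma tens_mul1l : left_id (1 \ox 1) tens_mul.
Proof.
apply: eq_linear_tens => // [|x y]; first exact: tens_mul_bilinear.2.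
by rewrite tens_mul_pure !mul1r.
Qed.

Lemma tens_mul1r : right_id (1 \ox 1) tens_mul.
Proof.
apply: (@eq_linear_tens _ _ _ _ (tens_mul^~ _)) => // [|x y].
  exact: tens_mul_bilinear.1.
by rewrite tens_mul_pure !mulr1.
Qed.

Lemma tens_mulA : associative tens_mul.
Proof.
have mb := tens_mul_bilinear.
move=> x y z; move: x; apply: eq_linear_tens; [by lin | by lin | move=> x1 x2].
move: y; apply: eq_linear_tens; [by lin | by lin | move=> y1 y2].
move: z; apply: eq_linear_tens; [by lin | by lin | move=> z1 z2].
by rewrite !tens_mul_pure !mulrA.
Qed.

Lemma comul_antipode h :
  comul (antipode h : H) =
  \tsum_(h1, h2 <- comul h) antipode h2 \ox antipode h1.
Proof.
have mb := tens_mul_bilinear.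
move: h; apply: (@convolution_inverse_unique _ tens_mul (1 \ox 1) _ _ comul).
- exact: tens_mul_bilinear.
- exact: tens_mulA.
- exact: tens_mul1l.
- exact: tens_mul1r.
- by lin.
- by lin.
- by lin.
- move=> h; rewrite -[1 \ox 1]comul1 -(@tsum_antipodel _ comul); last by lin.
  by apply: eq_tsum => *; rewrite comulM.
move=> h.
transitivity (\tsum_(h', h'' <- comul h) \tsum_(h1, h2 <- comul h')
  \tsum_(h3, h4 <- comul h'') (h1 * antipode h4) \ox (h2 * antipode h3)).
  apply: eq_tsum => h' h''; apply: eq_tsum => h1 h2.
  by rewrite tsum_tsum; [apply: eq_tsum => *; rewrite tsum_pure // | ]; lin.
rewrite tsum_comulA; last by lin.
rewrite -(@tsum_antipoder _ (fun z => z \ox 1)); last by lin.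
apply: eq_tsum => h1 h'.
rewrite -tsum_comulA; last by lin.
rewrite -(@tsum_counitl _ (fun z => (h1 * antipode z) \ox 1)); last by lin.
apply: eq_tsum => u h4.
by rewrite (@tsum_antipoder _ (fun z => (h1 * antipode h4) \ox z)); last by lin.
Qed.

Lemma antipode1 : antipode 1 = 1 :> H.
Proof.
have := antipodel (1 : H); rewrite comul1 tsum_pure; last by lin.
by rewrite mulr1 counit1 scale1r.
Qed.

Lemma counit_antipode h : counit (antipode h) = counit h.
Proof.
rewrite -(@tsum_counitr _ (fun z => counit (antipode z))); last by lin.
transitivity (\tsum_(h1, h2 <- comul h) counit (antipode h1 * h2)).
  by apply: eq_tsum => *; rewrite counitM mulrC.
rewrite (@tsum_antipodel _ (@counit _ H)); last by lin.
by rewrite counit1 -[LHS]/(counit h * 1) mulr1.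
Qed.

Section InverseAntipode.
Variable Sinv : H -> H.
Hypotheses (SK : cancel (antipode : H -> H) Sinv)
  (SinvK : cancel Sinv (antipode : H -> H)).

Lemma Sinv_linear : linear Sinv.
Proof.
move=> a x y; apply: (can_inj SK); rewrite SinvK.
by rewrite (linearP antipode) [in RHS]/= !SinvK.
Qed.

Lemma SinvM g h : Sinv (g * h) = Sinv h * Sinv g.
Proof. by apply: (can_inj SK); rewrite antipodeM !SinvK. Qed.

Lemma Sinv1 : Sinv 1 = 1.
Proof. by apply: (can_inj SK); rewrite antipode1 SinvK. Qed.

Lemma counit_Sinv h : counit (Sinv h) = counit h.
Proof. by rewrite -{2}(SinvK h) counit_antipode. Qed.

Lemma comul_Sinv h :
  comul (Sinv h) = \tsum_(h1, h2 <- comul h) Sinv h2 \ox Sinv h1.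
Proof.
have Sl := Sinv_linear.
rewrite -{2}(SinvK h) comul_antipode tsum_tsum; last by lin.
rewrite [LHS]tens_sum; apply: eq_tsum => x y.
by rewrite tsum_pure ?SK //; lin.
Qed.

Lemma tsum_Sinvr U (F : H -> U) h : linear F ->
  \tsum_(h1, h2 <- comul h) F (h2 * Sinv h1) = (counit h : k) *: F 1.
Proof.
move=> Fl; rewrite -linear_tsum //.
have -> : \tsum_(h1, h2 <- comul h) h2 * Sinv h1 = (counit h : k) *: 1 :> H.
  apply: (can_inj SK); rewrite linear_tsum; last by lin.
  rewrite linearZ /= antipode1 -antipoder; apply: eq_tsum => *.
  by rewrite antipodeM SinvK.
exact: linear_scale.
Qed.

Lemma tsum_comul_Sinv U (F : H -> H -> U) h : is_bilinear F ->
  tsum (comul (Sinv h)) F = \tsum_(h1, h2 <- comul h) F (Sinv h2) (Sinv h1).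
Proof.
move=> Fb; rewrite comul_Sinv tsum_tsum //.
by apply: eq_tsum => *; rewrite tsum_pure.
Qed.

End InverseAntipode.

Lemma tsum_comul_antipode U (F : H -> H -> U) h : is_bilinear F ->
  tsum (comul (antipode h)) F =
  \tsum_(h1, h2 <- comul h) F (antipode h2) (antipode h1).
Proof.
move=> Fb; rewrite comul_antipode tsum_tsum //.
by apply: eq_tsum => *; rewrite tsum_pure.
Qed.

End Hopf.

(** * The smash product as a Yetter-Drinfeld module *)

Lemma ma_act_bilinear (k : fieldType) (H : hopfAlgType k)
    (A : moduleAlgebra H) : is_bilinear (@ma_act k H A).
Proof. by case: (ma_module A). Qed.

Ltac lin_ext ::=
  lazymatch goal with
  | |- lincomb _ (ma_mul _ ?x) (ma_mul _ ?x) (ma_mul _ ?x) =>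
      apply: (lincomb_bil1 _ (ma_mul_bilinear _))
  | |- lincomb _ (ma_mul ?x _) (ma_mul ?x _) (ma_mul ?x _) =>
      apply: (lincomb_bil2 _ (ma_mul_bilinear _))
  | |- lincomb _ (ma_act _ ?x) (ma_act _ ?x) (ma_act _ ?x) =>
      apply: (lincomb_bil1 _ (ma_act_bilinear _))
  | |- lincomb _ (ma_act ?x _) (ma_act ?x _) (ma_act ?x _) =>
      apply: (lincomb_bil2 _ (ma_act_bilinear _))
  end.

Section Smash.
Variables (k : fieldType) (H : hopfAlgType k) (Sinv : H -> H).
Hypotheses (SK : cancel (antipode : H -> H) Sinv)
  (SinvK : cancel Sinv (antipode : H -> H)).
Variable A : moduleAlgebra H.
Implicit Types (U : lmodType k) (g h : H) (a b : A) (x : tens A H).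

Let Sl : linear Sinv := Sinv_linear SK SinvK.
Let act1 a : ma_act 1 a = a. Proof. by case: (ma_module A). Qed.
Let actM g h a : ma_act (g * h) a = ma_act g (ma_act h a).
Proof. by case: (ma_module A). Qed.

Definition smash_act h x : tens A H :=
  \tsum_(a, g <- x) \tsum_(h1, h' <- comul h) \tsum_(h2, h3 <- comul h')
    (ma_act h2 a \ox (h3 * g * Sinv h1)).

Definition smash_coact x : tens H (tens A H) :=
  \tsum_(a, g <- x) \tsum_(g1, g2 <- comul g) (antipode g2 \ox (a \ox g1)).

Lemma smash_act_bilinear : is_bilinear smash_act.
Proof. rewrite /smash_act; lin. Qed.

Lemma smash_coact_linear : linear smash_coact.
Proof. rewrite /smash_coact; lin. Qed.

Let actb := smash_act_bilinear.
Let coactl := smash_coact_linear.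

Lemma smash_act_pure h a g : smash_act h (a \ox g) =
  \tsum_(h1, h' <- comul h) \tsum_(h2, h3 <- comul h')
    (ma_act h2 a \ox (h3 * g * Sinv h1)).
Proof. by rewrite /smash_act tsum_pure //; lin. Qed.

Lemma tsum_smash_coact U (F : H -> tens A H -> U) a g : is_bilinear F ->
  tsum (smash_coact (a \ox g)) F =
  \tsum_(g1, g2 <- comul g) F (antipode g2) (a \ox g1).
Proof.
move=> Fb; rewrite /smash_coact tsum_pure; last by lin.
by rewrite tsum_tsum //; apply: eq_tsum => *; rewrite tsum_pure.
Qed.

Lemma smash_module : is_module smash_act.
Proof.
split=> [//|x|g h x].
  move: x; apply: eq_linear_tens => //; first exact: actb.2.
  move=> a g; rewrite smash_act_pure.
  rewrite tsum_comul1 ?tsum_comul1; try by lin.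
  by rewrite act1 (Sinv1 SK SinvK) mul1r mulr1.
move: x; apply: eq_linear_tens; [by lin | by lin | move=> a u].
rewrite !smash_act_pure tsum_comulM; last by lin.
transitivity (\tsum_(g1, g' <- comul g) \tsum_(g2, g3 <- comul g')
  \tsum_(h1, h' <- comul h) \tsum_(h2, h3 <- comul h')
   (ma_act (g2 * h2) a \ox (g3 * h3 * u * Sinv (g1 * h1)))).
  apply: eq_tsum => g1 g'; rewrite -tsumC; apply: eq_tsum => h1 h'.
  by rewrite tsum_comulM //; lin.
rewrite linear_tsum; last by lin.
under eq_tsum => g1 g' do rewrite -tsumC.
rewrite -tsumC; apply: eq_tsum => h1 h'.
rewrite linear_tsum; last by lin.
under eq_tsum => g1 g' do rewrite -tsumC.
rewrite -tsumC; apply: eq_tsum => h2 h3.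
rewrite smash_act_pure; do 2!apply: eq_tsum => ? ?.
by rewrite actM (SinvM SK SinvK) !mulrA.
Qed.

Lemma smash_comodule : is_comodule smash_coact.
Proof.
split=> [//|x|x].
  move: x; apply: eq_linear_tens => [|//|a g]; first by lin.
  rewrite tsum_smash_coact; last by lin.
  rewrite -[RHS](@tsum_counitr _ _ _ (fun g => a \ox g)); last by lin.
  by apply: eq_tsum => g1 g2; rewrite counit_antipode.
move: x; apply: eq_linear_tens => [||a g]; [by lin | by lin |].
rewrite !tsum_smash_coact; [| by lin | by lin].
transitivity (\tsum_(g1, g' <- comul g) \tsum_(g2, g3 <- comul g')
    antipode g3 \ox (antipode g2 \ox (a \ox g1))).
  by apply: eq_tsum => g1 g'; rewrite tsum_comul_antipode //; lin.
rewrite -tsum_comulA; last by lin.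
by apply: eq_tsum => g' g3; rewrite tsum_smash_coact //; lin.
Qed.

Lemma smash_yd h x :
  \tsum_(h1, h2 <- comul h) \tsum_(n, y <- smash_coact x)
    (h1 * n) \ox smash_act h2 y =
  \tsum_(h1, h2 <- comul h) \tsum_(n, y <- smash_coact (smash_act h1 x))
    (n * h2) \ox y.
Proof.
move: x; apply: eq_linear_tens => [||a u]; [by lin | by lin |].
pose F p q s := \tsum_(u1, u2 <- comul u) \tsum_(p1, p2 <- comul p)
  (p1 * antipode u2) \ox (ma_act q a \ox (s * u1 * Sinv p2)).
transitivity (\tsum_(p, h' <- comul h) \tsum_(q, s <- comul h') F p q s).
  transitivity (\tsum_(h1, h' <- comul h) \tsum_(p, h'' <- comul h')
      \tsum_(q, s <- comul h'') \tsum_(u1, u2 <- comul u)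
      (h1 * antipode u2) \ox (ma_act q a \ox (s * u1 * Sinv p))).
    apply: eq_tsum => h1 h'; rewrite tsum_smash_coact; last by lin.
    under [RHS]eq_tsum => p h'' do rewrite tsumC.
    rewrite tsumC; apply: eq_tsum => u1 u2; rewrite smash_act_pure.
    rewrite linear_tsum; last by lin.
    by apply: eq_tsum => p h''; rewrite linear_tsum //; lin.
  rewrite -tsum_comulA; last by lin.
  apply: eq_tsum => p h'; rewrite tsumC; apply: eq_tsum => q s.
  by rewrite tsumC.
symmetry.
transitivity (\tsum_(h', h3 <- comul h) \tsum_(p, t <- comul h')
  \tsum_(q, r <- comul t) \tsum_(r1, r2 <- comul r)
  \tsum_(u1, u2 <- comul u) \tsum_(p1, p2 <- comul p)
   (p1 * antipode u2 * (antipode r2 * h3)) \ox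
     (ma_act q a \ox (r1 * u1 * Sinv p2))).
  apply: eq_tsum => h' h3; rewrite smash_act_pure.
  rewrite (linear_tsum _ _ (coactl)) tsum_tsum; last by lin.
  apply: eq_tsum => p t.
  rewrite (linear_tsum _ _ (coactl)) tsum_tsum; last by lin.
  apply: eq_tsum => q r; rewrite tsum_smash_coact; last by lin.
  rewrite tsum_comulM; last by lin.
  rewrite tsum_comulM; last by lin.
  do 2!apply: eq_tsum => ? ?.
  rewrite (tsum_comul_Sinv SK SinvK); last by lin.
  by apply: eq_tsum => p1 p2; rewrite !antipodeM SinvK !mulrA.
rewrite tsum_comulA; last by lin.
apply: eq_tsum => p h'; rewrite tsum_comulA; last by lin.
apply: eq_tsum => q s; rewrite tsum_comulA; last by lin.
rewrite -(@tsum_counitr _ _ _ (F p q)); last by rewrite /F; lin.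
apply: eq_tsum => r v; rewrite {}/F scaler_tsum [LHS]tsumC.
apply: eq_tsum => u1 u2; rewrite scaler_tsum [LHS]tsumC.
apply: eq_tsum => p1 p2.
rewrite (@tsum_antipodel _ _ _ (fun z => (p1 * antipode u2 * z) \ox
  (ma_act q a \ox (r * u1 * Sinv p2)))) ?mulr1 //.
by lin.
Qed.

Definition smash_ydStruct : ydStruct H (tens A H) :=
  YDStruct smash_module smash_comodule smash_yd.

End Smash.

(** * Yetter-Drinfeld submodules *)

Section YetterDrinfeld.
Variables (k : fieldType) (H : hopfAlgType k).
Implicit Types U : lmodType k.

Section Sums.
Variables (M : lmodType k) (X : ydStruct H M).

Lemma yd_act_bilinear : is_bilinear (yd_act X).
Proof. by case: (yd_module X). Qed.

Lemma yd_coact_linear : linear (yd_coact X).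
Proof. by case: (yd_comodule X). Qed.

Lemma tsum_yd_counit U (F : M -> U) m : linear F ->
  \tsum_(n, m0 <- yd_coact X m) (counit n : k) *: F m0 = F m.
Proof.
move=> Fl; have [_ c1 _] := yd_comodule X.
rewrite -[in RHS](c1 m) linear_tsum //.
by apply: eq_tsum => *; rewrite linear_scale.
Qed.

Lemma tsum_yd_coactA U (F : H -> H -> M -> U) m : trilinear F ->
  \tsum_(n, m0 <- yd_coact X m) \tsum_(n1, n2 <- comul n) F n1 n2 m0 =
  \tsum_(n1, m' <- yd_coact X m) \tsum_(n2, m0 <- yd_coact X m') F n1 n2 m0.
Proof.
move=> Ft; have Gb := trilinear_tsum Ft; have [_ _ cA] := yd_comodule X.
have F1 x : is_bilinear (F x) by case: Ft => *; split=> [w|v] *; auto.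
transitivity (tsum (\tsum_(n, m0 <- yd_coact X m) \tsum_(n1, n2 <- comul n)
    n1 \ox (n2 \ox m0)) (fun x t => tsum t (F x))); [symmetry | rewrite cA].
  all: rewrite tsum_tsum //; apply: eq_tsum => ? ?.
  all: rewrite tsum_tsum //; apply: eq_tsum => ? ?.
  all: by rewrite tsum_pure ?tsum_pure.
Qed.

Lemma tsum_yd_compat U (F : H -> M -> U) h m : is_bilinear F ->
  \tsum_(h1, h2 <- comul h) \tsum_(n, m0 <- yd_coact X m)
    F (h1 * n) (yd_act X h2 m0) =
  \tsum_(h1, h2 <- comul h) \tsum_(n, m0 <- yd_coact X (yd_act X h1 m))
    F (n * h2) m0.
Proof.
move=> Fb; have := congr1 (fun t => tsum t F) (yd_compat X h m).
rewrite !tsum_tsum // => e.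
transitivity (\tsum_(h1, h2 <- comul h) tsum (\tsum_(n, m0 <- yd_coact X m)
    (h1 * n) \ox yd_act X h2 m0) F); [|rewrite e].
  all: apply: eq_tsum => ? ?; rewrite tsum_tsum //.
  all: by apply: eq_tsum => ? ?; rewrite tsum_pure.
Qed.

End Sums.

(* A subspace of a Yetter-Drinfeld module is a subcomodule as soon as it is
   stable under the dual algebra [H^*], which acts through [contract]. *)
Lemma ydStruct_sub (M N : lmodType k) (X : ydStruct H M) (i : {linear N -> M}) :
  injective i ->
  (forall h n, exists n', i n' = yd_act X h (i n)) ->
  (forall (phi : {linear H -> k^o}) n,
     exists n', i n' = contract phi (yd_coact X (i n))) ->
  exists Y : ydStruct H N, is_yd_morphism Y X i.
Proof.
move=> iI iact icoact.
have il : linear i := linearP i.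
have [actb act1 actM] := yd_module X; have [coactl _ coactA] := yd_comodule X.
have [actp actpE] := choice (fun p : H * N => iact p.1 p.2).
pose act h n := actp (h, n).
have iE h n : i (act h n) = yd_act X h (i n) by apply: actpE.
have /choice[coact coactE] n : exists t, tmap id i t = yd_coact X (i n).
  by apply: tmap_idl_im => // phi; apply: icoact.
have tiI : injective (tmap (@id H) i) := tmap_idl_inj il iI.
have idl : linear (@id H) by [].
have til : linear (tmap (@id H) i) by apply: tmap_linear.
have tsumE U (F : H -> M -> U) n : is_bilinear F ->
    \tsum_(u, n0 <- coact n) F u (i n0) = tsum (yd_coact X (i n)) F.
  by move=> Fb; rewrite -coactE tsum_tmap.
have actP : is_module act.
  split=> [|n|g h n]; [split=> [n|h] a x y | |]; apply: iI.
  - by rewrite iE actb.1 linearP !iE.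
  - by rewrite iE linearP actb.2 linearP !iE.
  - by rewrite iE act1.
  - by rewrite !iE actM.
have coactP : is_comodule coact.
  split=> [a x y|n|n].
  - by apply: tiI; rewrite til !coactE linearP coactl.
  - apply: iI; rewrite linear_tsum // -[RHS](tsum_yd_counit X _ (F := id)) //.
    rewrite -tsumE; last by lin.
    by apply: eq_tsum => *; rewrite linearZ.
  apply: (tmap_idl_inj til tiI).
  have ttl : linear (tmap (@id H) (tmap (@id H) i)) by apply: tmap_linear.
  transitivity (\tsum_(h, m0 <- yd_coact X (i n)) \tsum_(h1, h2 <- comul h)
     h1 \ox (h2 \ox m0)); [| rewrite coactA].
    rewrite linear_tsum // -tsumE; last by lin.
    apply: eq_tsum => h n0; rewrite linear_tsum //; apply: eq_tsum => h1 h2.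
    by rewrite !tmap_pure.
  rewrite linear_tsum // -tsumE; last by lin.
  apply: eq_tsum => h n0; rewrite linear_tsum // -tsumE; last by lin.
  by apply: eq_tsum => h1 h2; rewrite !tmap_pure.
have compat h n :
    \tsum_(h1, h2 <- comul h) \tsum_(u, n0 <- coact n) (h1 * u) \ox act h2 n0 =
    \tsum_(h1, h2 <- comul h) \tsum_(u, n0 <- coact (act h1 n)) (u * h2) \ox n0.
  apply: tiI.
  transitivity (\tsum_(h1, h2 <- comul h) \tsum_(u, m0 <- yd_coact X (i n))
     (h1 * u) \ox yd_act X h2 m0); [| rewrite yd_compat].
    rewrite linear_tsum //; apply: eq_tsum => h1 h2.
    rewrite linear_tsum // -tsumE; last by lin.
    by apply: eq_tsum => *; rewrite tmap_pure // iE.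
  rewrite linear_tsum //; apply: eq_tsum => h1 h2.
  rewrite linear_tsum // -iE -tsumE; last by lin.
  by apply: eq_tsum => *; rewrite tmap_pure.
exists (YDStruct actP coactP compat); split=> // n.
exact/esym/coactE.
Qed.

End YetterDrinfeld.

(** * The centraliser *)

Section Centraliser.
Variables (k : fieldType) (H : hopfAlgType k) (Sinv : H -> H).
Hypotheses (SK : cancel (antipode : H -> H) Sinv)
  (SinvK : cancel Sinv (antipode : H -> H)).
Variable A : moduleAlgebra H.
Implicit Types (U : lmodType k) (g h : H) (a b : A) (x : tens A H).

Let Sl : linear Sinv := Sinv_linear SK SinvK.
Let act1 a : ma_act 1 a = a. Proof. by case: (ma_module A). Qed.
Let actM g h a : ma_act (g * h) a = ma_act g (ma_act h a).
Proof. by case: (ma_module A). Qed.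
Let actb : is_bilinear (smash_act Sinv (A := A)) :=
  smash_act_bilinear SK SinvK A.
Let coactl : linear (@smash_coact k H A) := @smash_coact_linear k H A.
Let mulb : is_bilinear (@smash_mul k H A) := @smash_mul_bilinear k H A.

Lemma smash_mul_pure1 a g b :
  smash_mul (a \ox g) (b \ox 1) =
  \tsum_(g1, g2 <- comul g) ma_mul a (ma_act g1 b) \ox g2.
Proof.
rewrite /smash_mul tsum_pure ?tsum_pure; try by lin.
by apply: eq_tsum => *; rewrite mulr1.
Qed.

Lemma smash_mul_1pure a g b :
  smash_mul (b \ox 1) (a \ox g) = ma_mul b a \ox g.
Proof.
rewrite /smash_mul tsum_pure ?tsum_pure ?tsum_comul1; try by lin.
by rewrite act1 mul1r.
Qed.

(* The action with the legs of the acting element made independent. *)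
Let T h3 h4 h1 x : tens A H :=
  \tsum_(a, g <- x) ma_act h3 a \ox (h4 * g * Sinv h1).

Lemma smash_act_mulr h x b : smash_mul (smash_act Sinv h x) (b \ox 1) =
  \tsum_(h1, h' <- comul h) \tsum_(h2, h'' <- comul h')
    \tsum_(h3, h4 <- comul h'')
      T h3 h4 h1 (smash_mul x (ma_act (Sinv h2) b \ox 1)).
Proof.
move: x; apply: eq_linear_tens => [||a g]; [by lin | by rewrite /T; lin |].
rewrite smash_act_pure (linear_tsum _ _ (mulb.1 _)).
transitivity (\tsum_(h', h3 <- comul h) \tsum_(h1, h2 <- comul h')
   \tsum_(q, r <- comul h3) \tsum_(r1, r2 <- comul r) \tsum_(g1, g2 <- comul g)
     ma_mul (ma_act q a) (ma_act (r1 * g1 * Sinv h2) b) \ox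
       (r2 * g2 * Sinv h1)).
  apply: eq_tsum => h' h3; rewrite [RHS]tsumC (linear_tsum _ _ (mulb.1 _)).
  apply: eq_tsum => q r; rewrite smash_mul_pure1.
  rewrite tsum_comulM; last by lin.
  rewrite tsum_comulM; last by lin.
  rewrite [RHS]tsumC; apply: eq_tsum => r1 r2.
  rewrite [RHS]tsumC; apply: eq_tsum => g1 g2.
  by rewrite (tsum_comul_Sinv SK SinvK) //; lin.
rewrite tsum_comulA; last by lin.
do 2!apply: eq_tsum => ? ?; rewrite -tsum_comulA; last by lin.
apply: eq_tsum => h3 h4; rewrite smash_mul_pure1 linear_tsum;
  last by rewrite /T; lin.
rewrite tsumC; apply: eq_tsum => g1 g2; rewrite /T tsum_pure; last by lin.
rewrite ma_actM (linear_tsum _ _ ((tpure_bilinear _ _).1 _)).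
by apply: eq_tsum => *; rewrite !actM.
Qed.

Lemma smash_act_mull h x b : smash_mul (b \ox 1) (smash_act Sinv h x) =
  \tsum_(h1, h' <- comul h) \tsum_(h2, h'' <- comul h')
    \tsum_(h3, h4 <- comul h'')
      T h3 h4 h1 (smash_mul (ma_act (Sinv h2) b \ox 1) x).
Proof.
move: x; apply: eq_linear_tens => [||a g]; [by lin | by rewrite /T; lin |].
rewrite smash_act_pure (linear_tsum _ _ (mulb.2 _)).
apply: eq_tsum => h1 h'; rewrite (linear_tsum _ _ (mulb.2 _)).
pose F (x y h4 : H) := ma_mul (ma_act x b) (ma_act y a) \ox (h4 * g * Sinv h1).
transitivity (\tsum_(h2, h'' <- comul h') \tsum_(u, h4 <- comul h'')
    \tsum_(x, y <- comul u) F (x * Sinv h2) y h4); last first.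
  apply: eq_tsum => h2 h''; apply: eq_tsum => h3 h4.
  rewrite smash_mul_1pure /T tsum_pure; last by lin.
  rewrite ma_actM (linear_tsum _ _ ((tpure_bilinear _ _).1 _)).
  by apply: eq_tsum => *; rewrite /F actM.
transitivity (\tsum_(h2, h'' <- comul h') \tsum_(x, u <- comul h'')
    \tsum_(y, h4 <- comul u) F (x * Sinv h2) y h4); last first.
  by apply: eq_tsum => h2 h''; rewrite tsum_comulA // /F; lin.
rewrite -tsum_comulA; last by rewrite /F; lin.
pose G (x t : H) := \tsum_(y, h4 <- comul t) F x y h4.
transitivity (G 1 h').
  by apply: eq_tsum => *; rewrite smash_mul_1pure /F act1.
rewrite -(@tsum_counitl _ _ _ (G 1)); last by rewrite /G /F; lin.
apply: eq_tsum => s t.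
by rewrite -(tsum_Sinvr SK SinvK (F := G^~ t)) //; rewrite /G /F; lin.
Qed.

Lemma smash_coact_mulr x b : smash_coact (smash_mul x (b \ox 1)) =
  tmap id (fun y => smash_mul y (b \ox 1)) (smash_coact x).
Proof.
have ml : linear (fun y : tens A H => smash_mul y (b \ox 1)) by lin.
have idl : linear (@id H) by [].
have tl : linear (tmap (@id H) (fun y => smash_mul y (b \ox 1))).
  exact: tmap_linear.
move: x; apply: eq_linear_tens => [||a g]; [by lin | by lin |].
rewrite smash_mul_pure1 linear_tsum; last by lin.
rewrite /tmap tsum_smash_coact; last by lin.
transitivity (\tsum_(g', g3 <- comul g) \tsum_(g1, g2 <- comul g')
    antipode g3 \ox (ma_mul a (ma_act g1 b) \ox g2)).
  rewrite tsum_comulA; last by lin.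
  apply: eq_tsum => g1 g'.
  by rewrite /smash_coact tsum_pure //; lin.
apply: eq_tsum => g' g3; rewrite smash_mul_pure1.
by rewrite (linear_tsum _ _ ((tpure_bilinear _ _).2 _)).
Qed.

Lemma smash_coact_mull x b : smash_coact (smash_mul (b \ox 1) x) =
  tmap id (smash_mul (b \ox 1)) (smash_coact x).
Proof.
have ml : linear (smash_mul (b \ox 1) : tens A H -> _) by lin.
have idl : linear (@id H) by [].
have tl : linear (tmap (@id H) (smash_mul (b \ox 1) : tens A H -> _)).
  exact: tmap_linear.
move: x; apply: eq_linear_tens => [||a g]; [by lin | by lin |].
rewrite smash_mul_1pure /tmap tsum_smash_coact; last by lin.
rewrite /smash_coact tsum_pure; last by lin.
by apply: eq_tsum => *; rewrite smash_mul_1pure.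
Qed.

Lemma smash_act_centraliser h x :
  x \in @in_centraliser k H A -> smash_act Sinv h x \in @in_centraliser k H A.
Proof.
move=> /in_centraliserP xC; apply/in_centraliserP => b.
rewrite smash_act_mulr smash_act_mull.
by do 3!apply: eq_tsum => ? ?; rewrite xC.
Qed.

Lemma smash_coact_centraliser (phi : {linear H -> k^o}) x :
  x \in @in_centraliser k H A ->
  contract phi (smash_coact x) \in @in_centraliser k H A.
Proof.
move=> /in_centraliserP xC; apply/in_centraliserP => b.
have ml : linear (fun y : tens A H => smash_mul y (b \ox 1)) by lin.
have mr : linear (smash_mul (b \ox 1) : tens A H -> _) by lin.
rewrite -[LHS](contract_tmap ml) -[RHS](contract_tmap mr).
by rewrite -smash_coact_mulr -smash_coact_mull xC.
Qed.

Lemma centraliser_ydStruct : exists X : ydStruct H (centraliser A),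
  is_yd_morphism X (smash_ydStruct SK SinvK A)
    (\val : centraliser A -> tens A H).
Proof.
apply: ydStruct_sub => [|h z|phi z]; first exact: val_inj.
  by exists (Centraliser (smash_act_centraliser h (centraliserP z))).
by exists (Centraliser (smash_coact_centraliser phi (centraliserP z))).
Qed.

Definition smash_counit x : A := \tsum_(a, g <- x) (counit g : k) *: a.

Lemma smash_counit_linear : linear smash_counit.
Proof. rewrite /smash_counit; lin. Qed.

Let zetal := smash_counit_linear.

Lemma smash_counit_pure a g : smash_counit (a \ox g) = (counit g : k) *: a.
Proof. by rewrite /smash_counit tsum_pure //; lin. Qed.

Lemma smash_counit_act h x :
  smash_counit (smash_act Sinv h x) = ma_act h (smash_counit x).
Proof.
move: x; apply: eq_linear_tens => [||a g]; [by lin | by lin |].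
rewrite smash_act_pure smash_counit_pure linear_tsum; last by lin.
rewrite -(@tsum_counitl _ _ _ (fun h => ma_act h ((counit g : k) *: a)));
  last by lin.
apply: eq_tsum => h1 h'; rewrite linear_tsum; last by lin.
rewrite -(@tsum_counitr _ _ _ (fun h => ma_act h ((counit g : k) *: a)));
  last by lin.
rewrite scaler_tsum; apply: eq_tsum => h2 h3.
rewrite smash_counit_pure !counitM (counit_Sinv SinvK).
rewrite (linear_scale _ _ ((ma_act_bilinear A).2 h2)) !scalerA.
by rewrite [_ * counit h1]mulrC mulrA.
Qed.

Lemma smash_counit_mulr x b : smash_counit (smash_mul x (b \ox 1)) =
  \tsum_(a, g <- x) ma_mul a (ma_act g b).
Proof.
move: x; apply: eq_linear_tens => [||a g]; [by lin | by lin |].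
rewrite smash_mul_pure1 tsum_pure; last by lin.
rewrite linear_tsum // -(@tsum_counitr _ _ _ (fun g => ma_mul a (ma_act g b)));
  last by lin.
by apply: eq_tsum => *; rewrite smash_counit_pure.
Qed.

Lemma smash_counit_mull x b :
  smash_counit (smash_mul (b \ox 1) x) = ma_mul b (smash_counit x).
Proof.
move: x; apply: eq_linear_tens => [||a g]; [by lin | by lin |].
rewrite smash_mul_1pure !smash_counit_pure.
exact/esym/linear_scale/(ma_mul_bilinear A).2.
Qed.

Lemma smash_counit_coact x b :
  \tsum_(n, y <- smash_coact x)
    smash_counit (smash_mul y (ma_act n b \ox 1)) = ma_mul (smash_counit x) b.
Proof.
move: x; apply: eq_linear_tens => [||a g]; [by lin | by lin |].
rewrite tsum_smash_coact; last by lin.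
rewrite smash_counit_pure (linear_scale _ _ ((ma_mul_bilinear A).1 b)).
rewrite -[in RHS](act1 b).
rewrite -(@tsum_antipoder _ _ _ (fun z => ma_mul a (ma_act z b))); last by lin.
apply: eq_tsum => g1 g2; rewrite smash_counit_mulr tsum_pure; last by lin.
by rewrite actM.
Qed.

Lemma smash_reconstruct x :
  x = \tsum_(n, y <- smash_coact x) smash_counit y \ox Sinv n.
Proof.
move: x; apply: eq_linear_tens => [||a g]; [by [] | by lin |].
rewrite tsum_smash_coact; last by lin.
rewrite -(@tsum_counitl _ _ _ (fun g => a \ox g)); last by lin.
apply: eq_tsum => g1 g2; rewrite smash_counit_pure SK.
exact/esym/(linear_scale _ _ ((tpure_bilinear A H).1 g2)).
Qed.

Section Universal.
Variables (M : lmodType k) (X : ydStruct H M) (zeta : M -> A).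
Hypothesis zetaC : is_central_map X zeta.

Let zl : linear zeta. Proof. by case: zetaC. Qed.
Let zact h m : zeta (yd_act X h m) = ma_act h (zeta m).
Proof. by case: zetaC. Qed.
Let zcentral m a : ma_mul (zeta m) a =
  \tsum_(n, m0 <- yd_coact X m) ma_mul (ma_act n a) (zeta m0).
Proof. by case: zetaC => _ _ ->. Qed.
Let Xactb := yd_act_bilinear X.
Let Xcoactl := yd_coact_linear X.

Definition smash_lift m : tens A H :=
  \tsum_(n, m0 <- yd_coact X m) zeta m0 \ox Sinv n.

Lemma smash_lift_linear : linear smash_lift.
Proof. rewrite /smash_lift; lin. Qed.

Lemma smash_lift_counit m : smash_counit (smash_lift m) = zeta m.
Proof.
rewrite linear_tsum // -(tsum_yd_counit X _ zl); apply: eq_tsum => n m0.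
by rewrite smash_counit_pure (counit_Sinv SinvK).
Qed.

Lemma smash_lift_coact m : smash_coact (smash_lift m) =
  \tsum_(n, m0 <- yd_coact X m) n \ox smash_lift m0.
Proof.
rewrite linear_tsum //.
transitivity (\tsum_(n, m0 <- yd_coact X m) \tsum_(n1, n2 <- comul n)
   n1 \ox (zeta m0 \ox Sinv n2)).
  apply: eq_tsum => n m0; rewrite /smash_coact tsum_pure; last by lin.
  rewrite (tsum_comul_Sinv SK SinvK); last by lin.
  by apply: eq_tsum => *; rewrite SinvK.
rewrite tsum_yd_coactA; last by lin.
apply: eq_tsum => n m0.
by rewrite (linear_tsum _ _ ((tpure_bilinear _ _).2 _)).
Qed.

Lemma smash_lift_act h m :
  smash_lift (yd_act X h m) = smash_act Sinv h (smash_lift m).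
Proof.
pose G h3 u m0 := zeta m0 \ox (h3 * Sinv u).
transitivity (\tsum_(h', h3 <- comul h) \tsum_(h1, h2 <- comul h')
   \tsum_(n, m0 <- yd_coact X m) G h3 (h1 * n) (yd_act X h2 m0)); last first.
  rewrite linear_tsum; last by lin.
  rewrite tsum_comulA; last by rewrite /G; lin.
  transitivity (\tsum_(n, m0 <- yd_coact X m) \tsum_(h1, h' <- comul h)
      \tsum_(h2, h3 <- comul h') G h3 (h1 * n) (yd_act X h2 m0)).
    by rewrite [RHS]tsumC; apply: eq_tsum => h1 h'; rewrite [RHS]tsumC.
  apply: eq_tsum => n m0; rewrite smash_act_pure; do 2!apply: eq_tsum => ? ?.
  by rewrite /G zact (SinvM SK SinvK) mulrA.
transitivity (\tsum_(h1, h' <- comul h)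
    (counit h' : k) *: smash_lift (yd_act X h1 m)).
  rewrite (@tsum_counitr _ _ _ (fun h => smash_lift (yd_act X h m))) //.
  by have sl := smash_lift_linear; lin.
transitivity (\tsum_(h', h3 <- comul h) \tsum_(h1, h2 <- comul h')
   \tsum_(n, m0 <- yd_coact X (yd_act X h1 m)) G h3 (n * h2) m0); last first.
  by apply: eq_tsum => h' h3; rewrite tsum_yd_compat //; rewrite /G; lin.
rewrite tsum_comulA; last by rewrite /G; lin.
apply: eq_tsum => h1 h'; rewrite tsumC scaler_tsum; apply: eq_tsum => n m0.
rewrite -[Sinv n]mul1r.
rewrite -(tsum_Sinvr SK SinvK (F := fun z => zeta m0 \ox (z * Sinv n)));
  last by lin.
by apply: eq_tsum => h2 h3; rewrite /G (SinvM SK SinvK) mulrA.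
Qed.

Lemma smash_lift_centraliser m : smash_lift m \in @in_centraliser k H A.
Proof.
apply/in_centraliserP => b.
rewrite (linear_tsum _ _ (mulb.1 _)) (linear_tsum _ _ (mulb.2 _)).
transitivity (\tsum_(n, m0 <- yd_coact X m) \tsum_(n1, n2 <- comul n)
    (ma_mul (zeta m0) (ma_act (Sinv n2) b) \ox Sinv n1)).
  apply: eq_tsum => n m0; rewrite smash_mul_pure1.
  by rewrite (tsum_comul_Sinv SK SinvK) //; lin.
rewrite tsum_yd_coactA; last by lin.
apply: eq_tsum => n1 m'; rewrite smash_mul_1pure.
transitivity (\tsum_(n2, m0 <- yd_coact X m') \tsum_(n3, m1 <- yd_coact X m0)
    ma_mul (ma_act (n3 * Sinv n2) b) (zeta m1) \ox Sinv n1).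
  apply: eq_tsum => n2 m0; rewrite zcentral.
  rewrite (linear_tsum _ _ ((tpure_bilinear _ _).1 _)).
  by apply: eq_tsum => *; rewrite actM.
rewrite -tsum_yd_coactA; last by lin.
rewrite -(tsum_yd_counit X (F := fun m => ma_mul b (zeta m) \ox Sinv n1));
  last by lin.
apply: eq_tsum => n m0.
rewrite (tsum_Sinvr SK SinvK
  (F := fun z => ma_mul (ma_act z b) (zeta m0) \ox Sinv n1)) ?act1 //.
by lin.
Qed.

End Universal.

End Centraliser.

Section FullCentre.
Variables (k : fieldType) (H : hopfAlgType k) (Sinv : H -> H).
Hypotheses (SK : cancel (antipode : H -> H) Sinv)
  (SinvK : cancel Sinv (antipode : H -> H)).
Variables (A : moduleAlgebra H) (X : ydStruct H (centraliser A)).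
Let i : {linear centraliser A -> tens A H} := \val.
Hypothesis Xi : is_yd_morphism X (smash_ydStruct SK SinvK A) i.

Let il : linear i := linearP i.
Let idl : linear (@id H). Proof. by []. Qed.
Let Sl : linear Sinv := Sinv_linear SK SinvK.
Let mulb : is_bilinear (@smash_mul k H A) := @smash_mul_bilinear k H A.
Let zetal : linear (@smash_counit k H A) := @smash_counit_linear k H A.
Let iact h z : i (yd_act X h z) = smash_act Sinv h (i z).
Proof. by case: Xi => _ e _; apply: e. Qed.
Let icoact z : smash_coact (i z) = tmap id i (yd_coact X z).
Proof. by case: Xi => _ _ e; apply: e. Qed.

Lemma centraliser_central : is_central_map X (fun z => smash_counit (i z)).
Proof.
split=> [|h z|z b]; first by lin.
  by rewrite iact (smash_counit_act SK SinvK).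
rewrite -smash_counit_coact icoact tsum_tmap //; last by lin.
apply: eq_tsum => n z0.
by have /in_centraliserP -> := centraliserP z0; rewrite smash_counit_mull.
Qed.

Lemma centraliser_full_centre : is_full_centre X (fun z => smash_counit (i z)).
Proof.
split=> [|M Y zeta zetaC]; first exact: centraliser_central.
pose f m := Centraliser (smash_lift_centraliser SK SinvK zetaC m).
have fE m : i (f m) = smash_lift Sinv Y zeta m by [].
have tiI : injective (tmap (@id H) i) := tmap_idl_inj il val_inj.
have sl : linear (smash_lift Sinv Y zeta) by apply: smash_lift_linear.
have fl : linear f by move=> a m m'; apply: val_inj; rewrite [LHS]sl linearP.
exists f; split=> [|g [[gl _ gcoact] gzeta]].
  split=> [|m]; last by rewrite fE (smash_lift_counit SinvK zetaC).
  split=> // [h m|m].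
    apply: val_inj; rewrite [RHS]iact.
    exact: (smash_lift_act SK SinvK zetaC).
  apply: tiI; rewrite -icoact fE (smash_lift_coact SK SinvK zetaC).
  have ti : linear (tmap (@id H) i) by apply: tmap_linear.
  rewrite linear_tsum //; apply: eq_tsum => n m0.
  by rewrite tmap_pure.
apply/funext => m; apply: val_inj.
rewrite [RHS](smash_reconstruct SK SinvK) icoact gcoact.
rewrite tsum_tmap //; last by lin.
rewrite tsum_tsum; last by lin.
apply: eq_tsum => n m0; rewrite tsum_pure -?gzeta //.
by lin.
Qed.

End FullCentre.

Section Twist.
Variables (k : fieldType) (H : hopfAlgType k) (Sinv : H -> H).
Hypotheses (SK : cancel (antipode : H -> H) Sinv)
  (SinvK : cancel Sinv (antipode : H -> H)).
Variable A : moduleAlgebra H.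
Implicit Type x : tens A H.

Let Sl : linear Sinv := Sinv_linear SK SinvK.

Lemma twist_S2_linear : linear (@twist_S2 k H A).
Proof. rewrite /twist_S2; lin. Qed.

Lemma twist_S2_pure (a : A) (g : H) :
  twist_S2 (a \ox g) = a \ox antipode (antipode g).
Proof. by rewrite /twist_S2 tsum_pure //; lin. Qed.

Lemma twist_S2_act (h : H) x :
  twist_S2 (smash_act Sinv h x) =
  \tsum_(a, g <- twist_S2 x)
  \tsum_(h1, h' <- comul h) \tsum_(h2, h3 <- comul h')
    (ma_act h2 a \ox (antipode (antipode h3) * g * antipode h1)).
Proof.
have tl := twist_S2_linear; have actb := smash_act_bilinear SK SinvK A.
move: x; apply: eq_linear_tens => [||a g]; [by lin | by lin |].
rewrite smash_act_pure twist_S2_pure tsum_pure; last by lin.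
rewrite linear_tsum //; apply: eq_tsum => h1 h'.
rewrite linear_tsum //; apply: eq_tsum => h2 h3.
by rewrite twist_S2_pure !antipodeM SinvK.
Qed.

Lemma twist_S2_coact x :
  \tsum_(n, y <- smash_coact x) (n \ox twist_S2 y) =
  \tsum_(a, g <- twist_S2 x) \tsum_(g1, g2 <- comul g)
    (Sinv g2 \ox (a \ox g1)).
Proof.
have tl := twist_S2_linear; have coactl := @smash_coact_linear k H A.
move: x; apply: eq_linear_tens => [||a g]; [by lin | by lin |].
rewrite tsum_smash_coact ?twist_S2_pure ?tsum_pure; try by lin.
do 2![rewrite tsum_comul_antipode; last by lin].
by apply: eq_tsum => g1 g2; rewrite SK twist_S2_pure.
Qed.

End Twist.

Theorem mainTheorem1 (k : fieldType) (H : hopfAlgType k) (Sinv : H -> H)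
    (SK : cancel (antipode : H -> H) Sinv)
    (SinvK : cancel Sinv (antipode : H -> H))
    (A : moduleAlgebra H) :
  exists (X : ydStruct H (centraliser A)) (zeta : centraliser A -> A),
    [/\ is_full_centre X zeta,
        (forall (h : H) (z : centraliser A),
           (yd_act X h z : tens A H) =
           \tsum_(a, g <- z)
           \tsum_(h1, h' <- comul h) \tsum_(h2, h3 <- comul h')
             (ma_act h2 a \ox (h3 * g * Sinv h1))),
        (forall z : centraliser A,
           \tsum_(n, z0 <- yd_coact X z) (n \ox (z0 : tens A H)) =
           \tsum_(a, g <- z) \tsum_(g1, g2 <- comul g)
             (antipode g2 \ox (a \ox g1))),
        (forall (h : H) (z : centraliser A),
           twist_S2 (yd_act X h z) =
           \tsum_(a, g <- twist_S2 z)
           \tsum_(h1, h' <- comul h) \tsum_(h2, h3 <- comul h')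
             (ma_act h2 a \ox (antipode (antipode h3) * g * antipode h1))) &
        (forall z : centraliser A,
           \tsum_(n, z0 <- yd_coact X z) (n \ox twist_S2 z0) =
           \tsum_(a, g <- twist_S2 z) \tsum_(g1, g2 <- comul g)
             (Sinv g2 \ox (a \ox g1)))].
Proof.
have [X Xi] := centraliser_ydStruct SK SinvK A.
exists X, (fun z => smash_counit (centraliser_val z)).
have [_ iact coactE] := Xi.
have icoact z : smash_coact (centraliser_val z) =
    \tsum_(n, z0 <- yd_coact X z) n \ox (z0 : tens A H) by apply: coactE.
split.
- exact: (centraliser_full_centre Xi).
- exact: iact.
- by move=> z; rewrite -icoact.
- by move=> h z; rewrite iact (twist_S2_act SK SinvK).
move=> z; rewrite -(twist_S2_coact SK SinvK) icoact.
have tl := @twist_S2_linear k H A.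
rewrite tsum_tsum; last by lin.
by apply: eq_tsum => n z0; rewrite tsum_pure //; lin.
Qed.
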